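(* Let $1\le p\le n$, let $U\in St^n_p$, and let $I_p\subset\{1,\dots,n\}$ be a set of $p$ row indexes such that the corresponding rows of $U$ form a full rank $p\times p$ submatrix of $U$. Then $$T_{U}St^n_p=\left\{\Omega U\ \middle|\ \Omega=[\omega_{ij}]\in \mathrm{Skew}_{n\times n}(\mathbb R),\ \omega_{ij}=0\text{ whenever both } i\notin I_p\text{ and } j\notin I_p\right\}.$$
   Context: $St_p^n=\{U\in\mathcal M_{n\times p}(\mathbb R)\mid U^TU=\mathbb I_p\}$ is the orthogonal Stiefel manifold, regarded as an embedded submanifold of $\mathcal M_{n\times p}(\mathbb R)$, so that $T_USt_p^n$ is a linear subspace of $\mathcal M_{n\times p}(\mathbb R)$. $\mathrm{Skew}_{n\times n}(\mathbb R)$ is the space of real skew-symmetric $n\times n$ matrices. *)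

(* Defs.v *)
From mathcomp Require Import all_boot all_order all_algebra.
From mathcomp Require Import all_classical all_reals all_analysis.
Import Order.TTheory GRing.Theory Num.Theory.
Import numFieldNormedType.Exports.

Set Implicit Arguments.
Unset Strict Implicit.
Unset Printing Implicit Defensive.

Local Open Scope classical_set_scope.
Local Open Scope ring_scope.

Definition stiefel (R : realType) (n p : nat) : set 'M[R]_(n, p) :=
  [set U | U^T *m U = 1%:M].
Arguments stiefel : clear implicits.

(* C^infinity on the open interval ]-e, e[: differentiability being a local
   property, the values of g outside this interval are irrelevant. *)
Definition smooth_curve (R : realType) (V : normedModType R) (e : R)
    (g : R -> V) : Prop :=
  forall (k : nat) (t : R), - e < t < e -> derivable (g^`(k))%classic t 1.

(* Tangent space at x of an embedded submanifold M of V, as a subset of V: the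
   velocities at time 0 of the smooth curves in M, defined on some open
   interval around 0, that are at x at time 0. *)
Definition tangent_space (R : realType) (V : normedModType R) (M : set V)
    (x : V) : set V :=
  [set v | exists (e : R) (g : R -> V),
    [/\ 0 < e, smooth_curve e g, (forall t, - e < t < e -> M (g t)),
        g 0 = x & (g^`())%classic 0 = v]].

Definition row_submx (R : realType) (n p : nat) (I : {set 'I_n})
    (U : 'M[R]_(n, p)) : 'M[R]_(#|I|, p) :=
  rowsub (fun k : 'I_#|I| => enum_val k) U.

(* Main.v *)
Require Import Defs.
From mathcomp Require Import all_boot all_order all_algebra.
From mathcomp Require Import all_classical all_reals all_analysis.
From mathcomp Require Import ring.
Import Order.TTheory GRing.Theory Num.Theory.
Import numFieldNormedType.Exports.

Set Implicit Arguments.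
Unset Strict Implicit.

Local Open Scope classical_set_scope.
Local Open Scope ring_scope.

(* Differentiating g^T g = 1 shows that a velocity V at U satisfies
   V^T U + U^T V = 0. If W is a left inverse of U whose columns outside I_p
   vanish (it exists since the rows of U in I_p have full rank), then
   Omega := V W - (V W)^T + W^T V^T U W is skew-symmetric, has the required
   zeros and satisfies Omega U = V. Conversely, Omega U is the velocity at 0 of
   the Cayley curve t |-> (1 - t A)^-1 (1 + t A) U with A := Omega / 2, whose
   entries are rational functions of t without poles. *)

(** The product and inverse rules for derivatives produce the scaling of the regular module; as a
    ring product it is within reach of [mulrC] and [field]. *)
Lemma regular_scaleE (K : nzRingType) (a : K) (b : K^o) : a *: b = a * b.
Proof. by []. Qed.

Lemma skewmxP (R : realType) (n : nat) (A : 'M[R]_n) :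
  reflect (A^T = - A) (A \is skewmx).
Proof.
apply: (iffP (is_hermitianmxP _ _ _)) => [{2}->|AT].
  by rewrite expr1 scaleN1r opprK map_mx_id.
by rewrite expr1 scaleN1r map_mx_id // AT opprK.
Qed.

(** * Derivatives and smoothness of matrix-valued curves *)

Section MatrixCurves.
Context {R : realType}.

Lemma is_derive_mx {V : normedModType R} (m n : nat) (f : V -> 'M[R]_(m, n))
    (x v : V) (df : 'M[R]_(m, n)) :
  (forall i j, is_derive x v (fun y => f y i j) (df i j)) -> is_derive x v f df.
Proof.
move=> fdf.
have dfx : derivable f x v by apply/derivable_mxP => i j; have [] := fdf i j.
apply: DeriveDef => //; rewrite derive_mx //.
by apply/matrixP => i j; rewrite mxE; have [] := fdf i j.
Qed.

Lemma is_derive_mxE {V : normedModType R} (m n : nat) (f : V -> 'M[R]_(m, n))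
    (x v : V) (df : 'M[R]_(m, n)) i j :
  is_derive x v f df -> is_derive x v (fun y => f y i j) (df i j).
Proof.
move=> [dfx <-]; rewrite derive_mx // mxE.
by apply: DeriveDef => //; move/derivable_mxP : dfx; exact.
Qed.

Lemma is_derive_trmx {V : normedModType R} (m n : nat) (f : V -> 'M[R]_(m, n))
    (x v : V) (df : 'M[R]_(m, n)) :
  is_derive x v f df -> is_derive x v (fun y => (f y)^T) df^T.
Proof.
move=> fdf; apply: is_derive_mx => i j; rewrite mxE.
have -> : (fun y => (f y)^T i j) = (fun y => f y j i).
  by apply/funext => y; rewrite mxE.
exact: is_derive_mxE.
Qed.

Lemma is_derive_mulmx {V : normedModType R} (m n p : nat)
    (f : V -> 'M[R]_(m, n)) (g : V -> 'M[R]_(n, p)) (x v : V)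
    (df : 'M[R]_(m, n)) (dg : 'M[R]_(n, p)) :
  is_derive x v f df -> is_derive x v g dg ->
  is_derive x v (fun y => f y *m g y) (f x *m dg + df *m g x).
Proof.
move=> fdf gdg; apply: is_derive_mx => i j.
have -> : (fun y => (f y *m g y) i j) =
    \sum_(k < n) ((fun y => f y i k) * (fun y => g y k j)).
  by apply/funext => y; rewrite mxE fct_sumE.
have fE k := is_derive_mxE i k fdf.
have gE k := is_derive_mxE k j gdg.
apply: is_derive_eq; rewrite !mxE -big_split /=; apply: eq_bigr => k _.
by rewrite !regular_scaleE [g x k j * _]mulrC.
Qed.

Lemma is_derive_horner_mx (m n : nat) (P : 'M[{poly R}]_(m, n)) (t : R) :
  is_derive t 1 (fun t => map_mx (horner_eval t) P)
    (map_mx (horner_eval t) (map_mx (@deriv R) P)).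
Proof.
apply: is_derive_mx => i j; rewrite !mxE.
have -> : (fun y => (map_mx (horner_eval y) P) i j) = horner (P i j).
  by apply/funext => y; rewrite mxE.
exact: is_derive_poly.
Qed.

(** A single denominator for all entries keeps this class of curves closed under differentiation, by
    the quotient rule. *)
Definition rational_curve {m n : nat} (P : 'M[{poly R}]_(m, n)) (q : {poly R})
    (t : R) : 'M[R]_(m, n) := (q.[t])^-1 *: map_mx (horner_eval t) P.

Lemma is_derive_rational_curve (m n : nat) (P : 'M[{poly R}]_(m, n))
    (q : {poly R}) (t : R) : q.[t] != 0 ->
  is_derive t 1 (rational_curve P q)
    (rational_curve (q *: map_mx (@deriv R) P - q^`() *: P) (q ^+ 2) t).
Proof.
move=> qt; apply: is_derive_mx => i j.
have -> : (fun y => rational_curve P q y i j) =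
    (fun y => q.[y]^-1) * horner (P i j).
  by apply/funext => y; rewrite !mxE.
have qV : is_derive t 1 (fun y => q.[y]^-1) (- q.[t] ^- 2 *: q^`().[t]).
  exact: is_deriveV.
apply: is_derive_eq; rewrite !regular_scaleE !mxE /horner_eval.
by rewrite horner_exp hornerD hornerN !hornerM; field.
Qed.

(** The derivative is again a rational curve, with denominator [q ^+ 2], still without zeros; hence
    an induction on the order, for all [P] and [q] at once. *)
Lemma smooth_rational_curve (m n : nat) (P : 'M[{poly R}]_(m, n))
    (q : {poly R}) (e : R) : (forall t, q.[t] != 0) ->
  smooth_curve e (rational_curve P q).
Proof.
move=> q_neq0 k t _; elim: k P q q_neq0 t => [|k IHk] P q q_neq0 t.
  by have [] := is_derive_rational_curve P (q_neq0 t).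
have -> : ((rational_curve P q)^`(k.+1))%classic =
    ((rational_curve (q *: map_mx (@deriv R) P - q^`() *: P)
        (q ^+ 2))^`(k))%classic.
  rewrite /derive1n iterSr; congr iter; apply/funext => s.
  by rewrite derive1E; have [] := is_derive_rational_curve P (q_neq0 s).
by apply: IHk => s; rewrite horner_exp expf_neq0.
Qed.

End MatrixCurves.

(** * The Cayley transform of a skew-symmetric matrix *)

Lemma mulmx_trmx_eq0 (R : realDomainType) (n : nat) (v : 'rV[R]_n) :
  v *m v^T = 0 -> v = 0.
Proof.
move=> /matrixP/(_ 0 0); rewrite !mxE => vv0.
apply/rowP => i; rewrite mxE; apply/eqP; rewrite -sqrf_eq0 expr2.
have := @psumr_eq0P R _ predT (fun j => v 0 j * v 0 j).
rewrite (eq_bigr (fun j => v 0 j * v^T j 0)) => [H|j _]; last by rewrite mxE.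
by rewrite H // => j _; rewrite -expr2 sqr_ge0.
Qed.

(** If v (1 - A) = 0 then v = v A, so v v^T = v A v^T. This scalar equals its own transpose, which
    is its opposite since A is skew; so it is 0, and v = 0. *)
Lemma skew_sub1_unitmx (R : realFieldType) (n : nat) (A : 'M[R]_n) :
  A^T = - A -> 1%:M - A \in unitmx.
Proof.
move=> AT; rewrite -row_free_unit; apply: inj_row_free => v.
rewrite mulmxBr mulmx1 => /subr0_eq vA.
have s0 : v *m A *m v^T = 0.
  have /matrixP/(_ 0 0) : (v *m A *m v^T)^T = - (v *m A *m v^T).
    by rewrite !trmx_mul trmxK AT mulNmx mulmxN mulmxA.
  rewrite [LHS]mxE [RHS]mxE => /eqP; rewrite eq_sym eqNr => /eqP s0.
  by apply/matrixP => i j; rewrite !ord1 s0 mxE.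
by apply: mulmx_trmx_eq0; rewrite {1}vA.
Qed.

(** With D = 1 - A and E = 1 + A, X = D^-1 E U. As D^T = E and D commutes with E, the matrix D^-1 E
    is orthogonal, so X^T X = U^T U. *)
Lemma cayley_stiefel (R : realType) (n p : nat) (A : 'M[R]_n)
    (U X : 'M[R]_(n, p)) :
  A^T = - A -> stiefel R n p U -> (1%:M - A) *m X = (1%:M + A) *m U ->
  stiefel R n p X.
Proof.
rewrite /stiefel /= => AT UU.
set D := 1%:M - A; set E := 1%:M + A => DX.
have DT : D^T = E by rewrite linearB /= trmx1 AT opprK.
have ET : E^T = D by rewrite -DT trmxK.
have uD : D \in unitmx by exact: skew_sub1_unitmx.
have uE : E \in unitmx by rewrite -DT unitmx_tr.
have DE : D *m E = E *m D.
  rewrite mulmxBl mulmxDl !mul1mx mulmxDr mulmxBr mulmx1.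
  by rewrite opprD !addrA addrK subrK.
have XE : X = invmx D *m E *m U by rewrite -mulmxA -DX mulKmx.
have ED : invmx D *m E = E *m invmx D.
  by apply: (can_inj (mulKmx uD)); rewrite mulmxA mulmxV // mul1mx mulmxA DE mulmxK.
rewrite {1}XE XE !trmx_mul ET trmx_inv DT ED -!mulmxA (mulmxA (invmx E)).
by rewrite mulVmx // mul1mx (mulmxA D) mulmxV // mul1mx.
Qed.

(** * The linear condition on velocities, and the velocity of the Cayley curve *)

Lemma tangent_stiefelW (R : realType) (n p : nat) (U V : 'M[R]_(n, p)) :
  tangent_space (stiefel R n p) U V -> V^T *m U + U^T *m V = 0.
Proof.
move=> [e [g [e0 /(_ 0 0) g_smooth gM g0 gV]]].
have dg : is_derive (0 : R) 1 g V.
  by apply: DeriveDef; [apply: g_smooth; rewrite oppr_lt0 e0|rewrite -derive1E].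
have := is_derive_mulmx (is_derive_trmx dg) dg.
rewrite g0 addrC => -[_ <-].
(* The product g^T g is known to be 1 only on the interval ]-e, e[, which is enough for its
   derivative at 0. *)
rewrite (near_eq_derive (g := cst 1%:M)) ?derive_cst //.
near=> t; apply: gM; rewrite -ltr_norml.
by near: t; exists e => // s /=; rewrite sub0r normrN.
Unshelve. all: by end_near. Qed.

Lemma tangent_stiefel_skew (R : realType) (n p : nat) (U : 'M[R]_(n, p))
    (Omega : 'M[R]_n) :
  stiefel R n p U -> Omega^T = - Omega ->
  tangent_space (stiefel R n p) U (Omega *m U).
Proof.
move=> UU skO; set A := 2^-1 *: Omega.
have skA : A^T = - A by rewrite linearZ /= skO scalerN.
pose Ap : 'M[{poly R}]_n := 'X *: map_mx polyC A.
have ApE t : map_mx (horner_eval t) Ap = t *: A.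
  by apply/matrixP => i j; rewrite !mxE /horner_eval !hornerE.
have sktA t : (t *: A)^T = - (t *: A) by rewrite linearZ /= skA scalerN.
pose D := 1%:M - Ap; pose N := (1%:M + Ap) *m map_mx polyC U.
have DE t : map_mx (horner_eval t) D = 1%:M - t *: A.
  by rewrite map_mxB map_mx1 ApE.
have UE t : map_mx (horner_eval t) (map_mx polyC U) = U.
  by apply/matrixP => i j; rewrite !mxE /horner_eval hornerC.
have NE t : map_mx (horner_eval t) N = (1%:M + t *: A) *m U.
  by rewrite map_mxM map_mxD map_mx1 ApE UE.
have detD t : (\det D).[t] = \det (1%:M - t *: A).
  by rewrite -DE det_map_mx.
(* For every real t the matrix t A is skew, so 1 - t A is invertible: the curve has no poles. *)
have q_neq0 t : (\det D).[t] != 0.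
  by rewrite detD -unitfE -unitmxE; apply: skew_sub1_unitmx.
(* Cramer's rule: the inverse of [D] is [\adj D] divided by [\det D]. *)
pose g := rational_curve (\adj D *m N) (\det D).
have Dg t : (1%:M - t *: A) *m g t = (1%:M + t *: A) *m U.
  rewrite /g /rational_curve map_mxM map_mx_adj DE NE -scalemxAr mulmxA.
  by rewrite mul_mx_adj mul_scalar_mx scalerA detD mulVf ?scale1r // -detD.
have g0 : g 0 = U by have := Dg 0; rewrite scale0r subr0 addr0 !mul1mx.
have smg : smooth_curve 1 g by exact: smooth_rational_curve.
(* The curve is defined on the whole line, so the radius 1 is an arbitrary choice. *)
exists 1, g; split => //.
  by move=> t _; apply: cayley_stiefel (Dg t).
(* g'(0) is found by differentiating the relation Dg, not the quotient g. *)
have dg : is_derive (0 : R) 1 g ((g^`())%classic 0).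
  rewrite derive1E; apply: derivableP.
  by apply: (smg 0%N); rewrite oppr_lt0 ltr01.
have := is_derive_mulmx (is_derive_horner_mx D 0) dg.
have -> : (fun t => map_mx (horner_eval t) D *m g t) =
    (fun t => map_mx (horner_eval t) N).
  by apply/funext => t; rewrite DE NE.
move=> [_ dDg]; have [_] := is_derive_horner_mx N 0.
have dAp : map_mx (horner_eval 0) (map_mx (@deriv R) Ap) = A.
  by apply/matrixP => i j; rewrite !mxE /horner_eval !poly.derivE !hornerE.
have dD : map_mx (horner_eval 0) (map_mx (@deriv R) D) = - A.
  rewrite -[A in RHS]dAp; apply/matrixP => i j.
  rewrite !mxE /horner_eval derivB !hornerE.
  by case: (i == j); rewrite /= ?derivC ?poly.derivE !hornerE.
have dN : map_mx (horner_eval 0) (map_mx (@deriv R) N) = A *m U.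
  have -> : N = map_mx polyC U + 'X *: map_mx polyC (A *m U).
    by rewrite /N mulmxDl mul1mx -scalemxAl map_mxM.
  apply/matrixP => i j.
  by rewrite mxE [X in horner_eval 0 X]mxE [X in deriv X]mxE [X in _ + X]mxE
    ![map_mx polyC _ _ _]mxE /horner_eval !poly.derivE !hornerE.
(* At t = 0 the differentiated relation reads g'(0) - A U = A U, so g'(0) = 2 A U = Omega U. *)
rewrite dDg dN DE dD g0 scale0r subr0 mul1mx mulNmx => /eqP.
rewrite subr_eq -mulmxDl => /eqP ->; congr (_ *m _).
by rewrite -scalerDl -[2^-1]div1r -splitr scale1r.
Qed.

Lemma row_submx_linv (R : realType) (n p : nat) (I : {set 'I_n})
    (U : 'M[R]_(n, p)) : \rank (row_submx I U) = p ->
  exists2 W : 'M[R]_(p, n), W *m U = 1%:M &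
    forall k j, j \notin I -> W k j = 0.
Proof.
move=> rU; have fU : row_full (row_submx I U) by rewrite /row_full rU.
(* [row_submx I 1%:M] is the matrix selecting the rows in [I]; its columns outside [I] vanish, and
   so do those of the product. *)
exists (pinvmx (row_submx I U) *m row_submx I 1%:M).
  by rewrite -mulmxA /row_submx mul_rowsub_mx mul1mx; exact: mulVpmx.
move=> k j jI; rewrite mxE big1 // => l _; rewrite !mxE.
have [lj|_] := eqVneq (enum_val l) j; last by rewrite mulr0.
by rewrite -lj enum_valP in jI.
Qed.

(** [V *m W] maps U to V but need not be skew. Subtracting its transpose makes it skew and changes
    the image of U by - W^T V^T U; the third term, skew because V^T U is, cancels this change. Each
    term has a factor W on the right or W^T on the left, whence the zeros. *)
Lemma stiefel_velocity_skew (R : realType) (n p : nat) (I : {set 'I_n})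
    (U V : 'M[R]_(n, p)) : \rank (row_submx I U) = p ->
  V^T *m U + U^T *m V = 0 ->
  exists Omega : 'M[R]_n, [/\ Omega^T = - Omega,
    (forall i j, i \notin I -> j \notin I -> Omega i j = 0) &
    V = Omega *m U].
Proof.
move=> /row_submx_linv[W WU W0] /eqP; rewrite addrC addr_eq0 => /eqP UV.
exists (V *m W - (V *m W)^T + W^T *m (V^T *m U) *m W); split.
- rewrite !linearD linearN /= trmxK !trmx_mul !trmxK UV mulNmx mulmxN -!mulmxA.
  by rewrite opprK [in RHS](addrC (- _)).
- move=> i j iI jI; rewrite ![fun_of_matrix _ _ _]mxE.
  rewrite !big1 ?addr0 ?subr0 // => k _; first by rewrite W0 // mulr0.
    by rewrite W0 // mulr0.
  by rewrite W0 // mulr0.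
- rewrite !mulmxDl mulNmx trmx_mul -!mulmxA WU !mulmx1.
  by rewrite -addrA addNr addr0.
Qed.

Unset Implicit Arguments.
Set Strict Implicit.

Theorem theorem2p2 (R : realType) (n p : nat) (hp : (1 <= p)%N)
    (hpn : (p <= n)%N) (U : 'M[R]_(n, p)) (hU : stiefel R n p U)
    (Ip : {set 'I_n}) (hIp : #|Ip| = p) (hrank : \rank (row_submx Ip U) = p) :
  tangent_space (stiefel R n p) U =
  [set V : 'M[R]_(n, p) | exists Omega : 'M[R]_n,
    [/\ Omega \is skewmx,
        (forall i j : 'I_n, i \notin Ip -> j \notin Ip -> Omega i j = 0)
      & V = Omega *m U]].
Proof.
apply/seteqP; split => V.
  move=> /tangent_stiefelW UV.
  have [S [skS S0 ->]] := stiefel_velocity_skew hrank UV.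
  by exists S; split => //; apply/skewmxP.
by move=> [S [/skewmxP skS _ ->]]; exact: tangent_stiefel_skew.
Qed.
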